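(* Let $m\in\{1,2,\ldots\}$, let $\rho>0$ and $M\in S_\rho^-$. Then \[\partial_\rho^kM=\{z\in M^c\cap\Delta_\rho:\mathrm{d}(z,M)=k\rho\}\quad\text{for all integers }k\ge1,\] \[\partial_\rho^{-k}M=\{x\in M:\mathrm{d}(x,M^c\cap\Delta_\rho)=(k+1)\rho\}\quad\text{for all integers }k\ge0.\]
   Context: $\mathbb{R}^m$ carries the maximum norm $\|x\|_\infty=\max_{1\le j\le m}|x_j|$. For a point $x\in\mathbb{R}^m$ and nonempty $A\subset\mathbb{R}^m$, $\mathrm{d}(x,A)=\inf_{y\in A}\|x-y\|_\infty$, and $\mathrm{d}(x,\emptyset)=\infty$. $M^c$ is the complement in $\mathbb{R}^m$. $\Delta_\rho=\rho\mathbb{Z}^m$ and $S_\rho^-=\{M\subset\Delta_\rho:\emptyset\neq M\neq\Delta_\rho\}$. For $M\subset\Delta_\rho$ define $\partial^0_\rho M=\{x\in M:\exists z\in M^c\cap\Delta_\rho\text{ with }\|x-z\|_\infty=\rho\}$, and for integers $k\ge1$, $\partial^k_\rho M=\{z\in M^c\cap\Delta_\rho:\mathrm{d}(z,\partial^0_\rho M)=k\rho\}$ and $\partial^{-k}_\rho M=\{x\in M:\mathrm{d}(x,\partial^0_\rho M)=k\rho\}$. *)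

(* Defs.v *)
From mathcomp Require Import all_boot all_order all_algebra.
From mathcomp Require Import boolp classical_sets reals ereal topology normedtype.

Set Implicit Arguments.
Unset Strict Implicit.
Unset Printing Implicit Defensive.

Import Order.TTheory GRing.Theory Num.Theory.
Import numFieldNormedType.Exports.

Local Open Scope classical_set_scope.
Local Open Scope ring_scope.

(* The library norm [`|x|] on ['rV[R]_m] is the maximum norm
   [\big[maxr/0]_j `|x 0 j|] (see [mx_normrE]). *)

(* Extended-real valued: the distance to [set0] is [+oo] ([ereal_inf0]). *)
Definition dist_set (R : realType) (m : nat) (x : 'rV[R]_m)
    (A : set 'rV[R]_m) : \bar R :=
  ereal_inf [set `|x - y|%:E | y in A].

Definition grid (R : realType) (m : nat) (rho : R) : set 'rV[R]_m :=
  [set rho *: map_mx intr a | a in [set: 'rV[int]_m]].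

Arguments grid {R} m rho.

Definition digital_images (R : realType) (m : nat) (rho : R) :
    set (set 'rV[R]_m) :=
  [set M | [/\ M `<=` grid m rho, M !=set0 & M <> grid m rho]].

Arguments digital_images {R} m rho.

Definition layer0 (R : realType) (m : nat) (rho : R) (M : set 'rV[R]_m) :
    set 'rV[R]_m :=
  [set x | M x /\ exists2 z, (~` M `&` grid m rho) z & `|x - z| = rho].

(* A single family indexed by all integers, so that the index [- k] with
   [k = 0] denotes [layer0]. Note that [Negz k] is [- (k + 1)]. *)
Definition layer (R : realType) (m : nat) (rho : R) (k : int)
    (M : set 'rV[R]_m) : set 'rV[R]_m :=
  match k with
  | Posz 0 => layer0 rho M
  | Posz n.+1 => [set z | (~` M `&` grid m rho) z /\
                   dist_set z (layer0 rho M) = (n.+1%:R * rho)%:E]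
  | Negz n => [set x | M x /\
                dist_set x (layer0 rho M) = (n.+1%:R * rho)%:E]
  end.

(* Main.v *)
Require Import Defs.
From mathcomp Require Import all_boot all_order all_algebra.
From mathcomp Require Import boolp classical_sets reals ereal topology normedtype.
From mathcomp Require Import lra zify.

Import Order.TTheory GRing.Theory Num.Theory.
Import numFieldNormedType.Exports.

Local Open Scope classical_set_scope.
Local Open Scope ring_scope.

(** In the maximum norm the grid [rho Z^m] behaves like a graph whose edges
    join the points at distance [rho]: distances between grid points are
    natural multiples of [rho] ([grid_norm_nat]), and they are lengths of
    shortest paths, since moving every coordinate that differs by one step
    towards the target shortens the distance by [rho] ([grid_step]).

    A shortest path from [x] in [M] to a grid point [z] outside [M] has to
    leave [M] along some edge [(x', z')], and then
    [|x - x'| + rho + |z' - z| <= |x - z|] ([exit_edge]), where [x'] lies in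
    [layer0 rho M] because of its neighbour [z'].  This one inequality gives
    both halves of the theorem.  Seen from [z], the point [x'] is no farther
    than [x], so the distances from [z] to [M] and to its subset
    [layer0 rho M] agree ([dist_set_layer0_out]).
    Seen from [x], the point [x'] is closer than [z] by [rho]; conversely a
    point of [layer0 rho M] has a neighbour outside [M], so the distance from
    [x] to the complement exceeds that to [layer0 rho M] by exactly [rho]
    ([dist_set_layer0_in]).  The two families of layers are level sets of the
    distance to [layer0 rho M], the index [0] being covered because a grid
    point at distance [0] from a set of grid points belongs to it
    ([dist_set_grid0]). *)

Definition int_norm {m : nat} (a : 'rV[int]_m) : nat :=
  \max_(i : 'I_1 * 'I_m) `|a i.1 i.2|%N.

Lemma norm_scale_intr {R : realType} {m : nat} {rho : R} (a : 'rV[int]_m) :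
  0 < rho -> `|rho *: map_mx intr a| = (int_norm a)%:R * rho.
Proof.
move=> rho0; rewrite normrZ gtr0_norm // mulrC; congr (_ * rho).
rewrite [LHS]mx_normrE /int_norm.
rewrite (big_morph (fun n : nat => n%:R : R) (id1 := 0) (op1 := Num.max)) //.
- by apply: eq_bigr => i _; rewrite mxE natr_absz intr_norm.
- by move=> p q; rewrite natr_max.
Qed.

Lemma int_norm_le {m : nat} (a : 'rV[int]_m) (n : nat) :
  (forall j, `|a ord0 j| <= n)%N -> (int_norm a <= n)%N.
Proof. by move=> an; apply/bigmax_leqP => -[i j] _ /=; rewrite (ord1 i). Qed.

Lemma int_norm_ge {m : nat} (a : 'rV[int]_m) (j : 'I_m) :
  (`|a ord0 j| <= int_norm a)%N.
Proof. exact: (leq_bigmax_cond (ord0, j)). Qed.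

(** Take for [s] the vector of the signs of the entries of [a].  Every nonzero
    entry, hence every entry of maximal absolute value, then moves by one
    towards [0], while the zero entries stay. *)
Lemma int_norm_step {m : nat} {a : 'rV[int]_m} {n : nat} :
  a != 0 -> (int_norm a <= n.+1)%N ->
  exists2 s : 'rV[int]_m, int_norm s = 1%N & (int_norm (a - s) <= n)%N.
Proof.
move=> a0 an; exists (map_mx (@sgz int) a).
  apply/eqP; rewrite eqn_leq; apply/andP; split.
    by apply: int_norm_le => j; rewrite mxE; case: sgzP.
  rewrite lt0n; apply: contraNneq a0 => s0; apply/eqP/rowP => j.
  have := int_norm_ge (map_mx (@sgz int) a) j.
  by rewrite s0 !mxE leqn0 absz_eq0 sgz_eq0 => /eqP.
apply: int_norm_le => j; rewrite !mxE.
have := leq_trans (int_norm_ge a j) an.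
by move: (a ord0 j) => t; case: sgzP; lia.
Qed.

Lemma grid_norm_nat {R : realType} {m : nat} {rho : R} {x y : 'rV[R]_m} :
  0 < rho -> grid m rho x -> grid m rho y ->
  exists n : nat, `|x - y| = n%:R * rho.
Proof.
move=> rho0 [a _ <-] [b _ <-]; exists (int_norm (a - b)).
by rewrite -scalerBr -map_mxB norm_scale_intr.
Qed.

Lemma grid_step {R : realType} {m : nat} {rho : R} {x y : 'rV[R]_m} {n : nat} :
  0 < rho -> grid m rho x -> grid m rho y -> x <> y ->
  `|x - y| <= n.+1%:R * rho ->
  exists w, [/\ grid m rho w, `|x - w| = rho & `|w - y| <= n%:R * rho].
Proof.
move=> rho0 [a _ <-] [b _ <-] xy.
rewrite -scalerBr -map_mxB norm_scale_intr // ler_pM2r // ler_nat => abn.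
have ab0 : a - b != 0.
  by rewrite subr_eq0; apply/eqP => ab; apply: xy; rewrite ab.
have [s s1 sn] := int_norm_step ab0 abn.
exists (rho *: map_mx intr (a - s)); split; first by exists (a - s).
- by rewrite -scalerBr -map_mxB norm_scale_intr // subKr s1 mul1r.
- by rewrite -scalerBr -map_mxB norm_scale_intr // addrAC ler_pM2r // ler_nat.
Qed.

(** Follow a shortest path from [x] to [z] up to the edge [(x', z')] along
    which it first leaves [M]. *)
Lemma exit_edge {R : realType} {m : nat} {rho : R} {M : set 'rV[R]_m}
    {x z : 'rV[R]_m} :
  0 < rho -> M `<=` grid m rho -> M x -> (~` M `&` grid m rho) z ->
  exists x' z', [/\ M x', (~` M `&` grid m rho) z', `|x' - z'| = rho &
    `|x - x'| + rho + `|z' - z| <= `|x - z|].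
Proof.
move=> rho0 Mgrid Mx [nMz gz].
have [n xzn] := grid_norm_nat rho0 (Mgrid _ Mx) gz.
rewrite xzn; have {xzn} : `|x - z| <= n%:R * rho by rewrite xzn.
elim: n x Mx => [|n IHn] x Mx xzn.
  move: xzn; rewrite mul0r normr_le0 subr_eq0 => /eqP xz.
  by rewrite xz in Mx.
have xz : x <> z by move=> xz; rewrite xz in Mx.
have [w [gw xw wz]] := grid_step rho0 (Mgrid _ Mx) gz xz xzn.
have nS : n.+1%:R * rho = rho + n%:R * rho by rewrite -nat1r mulrDl mul1r.
have [Mw|nMw] := EM (M w).
  have [x' [z' [Mx' nMz' xz' le_n]]] := IHn w Mw wz.
  exists x', z'; split=> //.
  by have := ler_distD w x x'; rewrite xw nS; lra.
exists x, w; split=> //.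
by rewrite subrr normr0 add0r nS lerD2l.
Qed.

Lemma dist_set_le {R : realType} {m : nat} {x y : 'rV[R]_m}
    {A : set 'rV[R]_m} :
  A y -> (dist_set x A <= `|x - y|%:E)%E.
Proof. by move=> Ay; apply: ereal_inf_lbound; exists y. Qed.

Lemma le_dist_set {R : realType} {m : nat} {x : 'rV[R]_m} {A : set 'rV[R]_m}
    {u : \bar R} :
  (forall y, A y -> (u <= `|x - y|%:E)%E) -> (u <= dist_set x A)%E.
Proof. by move=> uA; apply: le_ereal_inf_tmp => _ [y Ay <-]; apply: uA. Qed.

Lemma dist_set_mem {R : realType} {m : nat} {x : 'rV[R]_m}
    {A : set 'rV[R]_m} :
  A x -> dist_set x A = 0%E.
Proof.
move=> Ax; apply/eqP; rewrite eq_le; apply/andP; split.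
  by have := dist_set_le (x := x) Ax; rewrite subrr normr0.
by apply: le_dist_set => y _; rewrite lee_fin.
Qed.

(** Distances in the grid that are smaller than [rho] vanish, so an infimum
    equal to [0] is attained. *)
Lemma dist_set_grid0 {R : realType} {m : nat} {rho : R} {x : 'rV[R]_m}
    {A : set 'rV[R]_m} :
  0 < rho -> A `<=` grid m rho -> grid m rho x ->
  dist_set x A = 0%E -> A x.
Proof.
move=> rho0 Agrid gx dx0.
have : (dist_set x A < rho%:E)%E by rewrite dx0 lte_fin.
move=> /ereal_inf_lt[_ [y Ay <-]]; rewrite lte_fin.
have [n xyn] := grid_norm_nat rho0 gx (Agrid _ Ay).
rewrite xyn -[ltRHS]mul1r ltr_pM2r // ltrn1 ltnS leqn0 => /eqP n0.
move: xyn; rewrite n0 mul0r => /normr0_eq0/eqP.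
by rewrite subr_eq0 => /eqP ->.
Qed.

(** For [x] in [M] the edge [(x', z')] of [exit_edge] gives a path from [z] to
    [x'] through [z'] that is no longer than [|x - z|]. *)
Lemma dist_set_layer0_out {R : realType} {m : nat} {rho : R}
    {M : set 'rV[R]_m} {z : 'rV[R]_m} :
  0 < rho -> M `<=` grid m rho -> (~` M `&` grid m rho) z ->
  dist_set z (layer0 rho M) = dist_set z M.
Proof.
move=> rho0 Mgrid nMz; apply/eqP; rewrite eq_le; apply/andP; split.
  apply: le_dist_set => x Mx.
  have [x' [z' [Mx' nMz' xz' le_xz]]] := exit_edge rho0 Mgrid Mx nMz.
  have Lx' : layer0 rho M x' by split=> //; exists z'.
  apply: le_trans (dist_set_le Lx') _; rewrite lee_fin.
  have := ler_distD z' z x'.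
  rewrite (distrC z x) (distrC z z') (distrC z' x') xz'.
  by have := normr_ge0 (x - x'); lra.
by apply: le_dist_set => x [Mx _]; apply: dist_set_le.
Qed.

(** The extra [rho] is the length of one edge: the edge from a point of the layer
    to a neighbour outside [M] for one inequality, the exit edge of a shortest
    path for the other.  The equality also holds when both distances are
    [+oo]. *)
Lemma dist_set_layer0_in {R : realType} {m : nat} {rho : R}
    {M : set 'rV[R]_m} {x : 'rV[R]_m} :
  0 < rho -> M `<=` grid m rho -> M x ->
  dist_set x (~` M `&` grid m rho) = (dist_set x (layer0 rho M) + rho%:E)%E.
Proof.
move=> rho0 Mgrid Mx; apply/eqP; rewrite eq_le; apply/andP; split.
  rewrite -leeBlDr //; apply: le_dist_set => y [_ [z nMz yz]].
  rewrite leeBlDr //; apply: le_trans (dist_set_le nMz) _.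
  by rewrite -EFinD lee_fin -yz ler_distD.
apply: le_dist_set => z nMz.
have [x' [z' [Mx' nMz' xz' le_xz]]] := exit_edge rho0 Mgrid Mx nMz.
have Lx' : layer0 rho M x' by split=> //; exists z'.
rewrite -leeBrDr //; apply: le_trans (dist_set_le Lx') _.
rewrite -EFinB lee_fin.
by have := normr_ge0 (z' - z); lra.
Qed.

(** Index [0], where the layer is [layer0] by definition, falls under the same
    description as the negative indices. *)
Lemma layer_opp {R : realType} {m : nat} {rho : R} {M : set 'rV[R]_m}
    (k : nat) :
  0 < rho -> M `<=` grid m rho ->
  layer rho (- k%:Z) M =
  [set x | M x /\ dist_set x (layer0 rho M) = (k%:R * rho)%:E].
Proof.
move=> rho0 Mgrid; case: k => [|k]; last by rewrite -NegzE.
rewrite oppr0 mul0r; apply/seteqP; split=> x /=.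
  by move=> Lx; split; [case: Lx | apply: dist_set_mem].
move=> [Mx]; apply: dist_set_grid0 (Mgrid _ Mx) => // y [My _].
exact: Mgrid.
Qed.

Theorem theorem13 (R : realType) (m : nat) (rho : R) (M : set 'rV[R]_m)
    (hm : (1 <= m)%N) (hrho : 0 < rho) (hM : digital_images m rho M) :
  (forall k : nat, (1 <= k)%N ->
     layer rho k%:Z M =
     [set z | (~` M `&` grid m rho) z /\
              dist_set z M = (k%:R * rho)%:E]) /\
  (forall k : nat,
     layer rho (- k%:Z) M =
     [set x | M x /\
              dist_set x (~` M `&` grid m rho) = ((k + 1)%:R * rho)%:E]).
Proof.
have [Mgrid _ _] := hM; split=> k.
  case: k => [//|k] _; apply/seteqP; split=> z [nMz];
    by rewrite /= (dist_set_layer0_out hrho Mgrid nMz).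
have kS : ((k + 1)%:R * rho)%:E = ((k%:R * rho)%:E + rho%:E)%E.
  by rewrite natrD mulrDl mul1r EFinD.
rewrite layer_opp //; apply/seteqP; split=> x [Mx] /= dx; split=> //.
  by rewrite (dist_set_layer0_in hrho Mgrid Mx) dx kS.
move: dx; rewrite (dist_set_layer0_in hrho Mgrid Mx) kS => dx.
by have := congr1 (fun u => u - rho%:E)%E dx; rewrite !addeK.
Qed.
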